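(* Let $v$ be a polynomial vector field on $\mathbb{C}^2$ of degree $d$ having $d^2$ non-degenerate singularities. Then $$\sum_{v(p)=0}\frac{1}{\det(Dv(p))}=0,$$ where the sum runs over all zeros $p\in\mathbb{C}^2$ of $v$.
   Context: A polynomial vector field of degree $d$ on $\mathbb{C}^2$ is $v=P(x,y)\frac{\partial}{\partial x}+Q(x,y)\frac{\partial}{\partial y}$ with $P,Q\in\mathbb{C}[x,y]$ and $\max(\deg P,\deg Q)=d$. A singularity of $v$ is a point $p\in\mathbb{C}^2$ with $v(p)=0$; it is non-degenerate if the linearization matrix $Dv(p)$ (the Jacobian matrix of $(P,Q)$ at $p$) is invertible. Having $d^2$ non-degenerate singularities means that $v$ has exactly $d^2$ distinct zeros in $\mathbb{C}^2$, all of them non-degenerate.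
   Formalization: The degree d = 1 is excluded, because the claim is false there: the field x∂/∂x + y∂/∂y has a single non-degenerate zero and the sum equals 1; every other degree d is covered. *)

(* Defs.v *)
From mathcomp Require Import all_boot all_order all_algebra.
From mathcomp Require Import classical_sets cardinality fsbigop reals.
From mathcomp Require Import complex mpoly.
Set Implicit Arguments.
Unset Strict Implicit.
Unset Printing Implicit Defensive.
Import Order.TTheory GRing.Theory Num.Theory.
Local Open Scope ring_scope.
Local Open Scope classical_set_scope.

(* Here [R] is the field of real numbers and [R[i]] that of complex numbers. *)
Definition cplane (R : realType) := 'rV[R[i]]_2.

(* [v] stands for P d/dx + Q d/dy with P = [v 0 0] and Q = [v 0 1]. *)
Definition vfield (R : realType) := 'rV[{mpoly R[i][2]}]_2.

Definition eval_vf (R : realType) (v : vfield R) (p : cplane R) : cplane R :=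
  \row_i (v 0 i).@[fun j => p 0 j].

(* [msize] is the total degree plus one, and [msize 0 = 0]: the zero field has
   no degree. *)
Definition has_degree (R : realType) (v : vfield R) (d : nat) : Prop :=
  maxn (msize (v 0 0)) (msize (v 0 1)) = d.+1.

Definition singularities (R : realType) (v : vfield R) : set (cplane R) :=
  [set p | eval_vf v p = 0].

Definition linearization_at (R : realType) (v : vfield R) (p : cplane R)
    : 'M[R[i]]_2 :=
  \matrix_(i, j) ((v 0 i)^`M(j)).@[fun k => p 0 k].

Definition nondegenerate_at (R : realType) (v : vfield R) (p : cplane R)
    : Prop :=
  linearization_at v p \in unitmx.

(* Main.v *)
From HB Require Import structures.
Require Import Defs.
From mathcomp Require Import all_boot all_order all_algebra.
From mathcomp Require Import classical_sets cardinality fsbigop reals.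
From mathcomp Require Import complex mpoly.
From mathcomp Require Import zify ring.
Set Implicit Arguments.
Unset Strict Implicit.
Unset Printing Implicit Defensive.
Import Order.TTheory GRing.Theory Num.Theory.
Local Open Scope ring_scope.

(** This is the Euler-Jacobi formula in the plane. Write [v = (P, Q)], let [Z]
be its set of zeros, [D = d ^ 2 = #|Z|], and assume [d >= 2] (for [d = 0] the
sum is empty).

The sum is moved from [Z] to a grid. Choose sets [X] and [Y] of exactly [D]
numbers containing the first, respectively second, coordinates of the points
of [Z], and put [r(x) = \prod_(a in X) (x - a)], [s(y) = \prod_(b in Y) (y - b)].
Both polynomials vanish on [Z], and the key fact [max_noether] writes
[r = A1 P + B1 Q], [s = A2 P + B2 Q] with coefficients of degree at most
[D - d]. Let [h = A1 B2 - A2 B1]. Differentiating these identities at a point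
[p] of [Z] gives [h(p) det Dv(p) = r'(p) s'(p)], and the right-hand side is
nonzero because [r] and [s] have simple roots; at a point of the grid [X * Y]
outside [Z] the vector [(P, Q)] is nonzero and is killed by the matrix of the
coefficients, so [h] vanishes. Hence the sum of [1 / det Dv] over [Z] is the
sum of [h / (r' s')] over the grid. As [deg h <= 2 D - 2 d < 2 D - 2], every
monomial [x^i y^j] of [h] has [i < D - 1] or [j < D - 1], and its sum over the
grid has a factor [\sum_(a in X) a^i / r'(a)] (or the same for [Y]), which is
zero by Lagrange interpolation ([sum_expr_div_deriv], [grid_sum]).

The key fact is a case of Max Noether's theorem: for [m >= D - 1] and
[m >= 2 d], a polynomial of degree at most [m] that vanishes on [Z] is
[A P + B Q] with [A] and [B] of degree at most [m - d]. It is proved by a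
dimension count. Let [N m = (m + 1) (m + 2) / 2] be the dimension of the space
of polynomials of degree at most [m]. Relations [A P + B Q = 0] all come from
[(A, B) = (C Q, - C P)] ([dvd_of_syzygy]), so the polynomials [A P + B Q] form
a space of dimension at least [2 N (m - d) - N (m - 2 d) = N m - D]. This
space lies in the space of polynomials vanishing on [Z], whose dimension is
[N m - D] because the points of [Z] impose independent conditions in degree
[m] ([limg_evals]). So the two spaces coincide. *)

(** * Lagrange interpolation on one line *)

Section Univariate.
Variable K : fieldType.
Implicit Types (X : seq K) (a : K).

Definition rootpoly X : {poly K} := \prod_(a <- X) ('X - a%:P).

Lemma deriv_rootpoly X a : uniq X -> a \in X ->
  (rootpoly X)^`().[a] = \prod_(b <- rem a X) (a - b).
Proof.
move=> uX aX; rewrite /rootpoly (big_rem _ aX) /= derivM derivXsubC mul1r.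
rewrite hornerD hornerM hornerXsubC subrr mul0r addr0 horner_prod.
by apply: eq_bigr => b _; rewrite hornerXsubC.
Qed.

Lemma deriv_rootpoly_neq0 X a : uniq X -> a \in X ->
  (rootpoly X)^`().[a] != 0.
Proof.
move=> uX aX; rewrite deriv_rootpoly // prodf_seq_neq0; apply/allP=> b.
by rewrite mem_rem_uniq // inE subr_eq0 eq_sym => /andP[].
Qed.

(** Lagrange interpolation at the points of [X] reproduces ['X^i], whose degree
is less than [size X]; the sum is the coefficient of degree [(size X).-1] of the
interpolating polynomial. *)
Lemma sum_expr_div_deriv X i : uniq X -> (i.+1 < size X)%N ->
  \sum_(a <- X) a ^+ i / (rootpoly X)^`().[a] = 0.
Proof.
move=> uX ltiX; pose w a := a ^+ i / (rootpoly X)^`().[a].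
pose L : {poly K} :=
  \sum_(a <- X) w a *: \prod_(b <- rem a X) ('X - b%:P) - 'X^i.
have szterm a : a \in X -> size (\prod_(b <- rem a X) ('X - b%:P)) = size X.
  move=> aX; rewrite size_prod_XsubC size_rem // prednK //.
  by case: X aX {uX ltiX w L}.
have Lroot a : a \in X -> root L a.
  move=> aX; rewrite rootE hornerD hornerN hornerXn horner_sum.
  rewrite (big_rem _ aX) /= hornerZ horner_prod.
  under eq_bigr do rewrite hornerXsubC.
  rewrite -deriv_rootpoly // /w (divfK (deriv_rootpoly_neq0 uX aX)).
  rewrite big1_seq ?addr0 ?subrr //.
  move=> b /andP[_ ]; rewrite mem_rem_uniq // inE => /andP[nba bX].
  apply/eqP; rewrite hornerZ mulf_eq0 horner_prod prodf_seq_eq0.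
  apply/orP; right; apply/hasP; exists a; last by rewrite /= hornerXsubC subrr.
  by rewrite mem_rem_uniq // inE eq_sym nba.
have szL : (size L <= size X)%N.
  rewrite (leq_trans (size_polyD _ _)) // geq_max size_polyN size_polyXn.
  rewrite (ltnW ltiX) andbT big_seq.
  elim/big_ind: _ => [|p q szp szq|a aX]; first by rewrite size_poly0.
    by rewrite (leq_trans (size_polyD _ _)) // geq_max szp.
  by rewrite (leq_trans (size_scale_leq _ _)) // szterm.
have L0 : L = 0.
  apply/eqP/negPn/negP=> L_neq0.
  have allL : all (root L) X by apply/allP.
  by have := max_poly_roots L_neq0 allL uX; rewrite ltnNge szL.
have := congr1 (fun p : {poly K} => p`_(size X).-1) L0.
rewrite coef0 coefB coef_sum coefXn.
have -> : ((size X).-1 == i) = false by apply/negbTE; lia.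
rewrite subr0 => sum0; rewrite -[RHS]sum0; apply: eq_big_seq => a aX.
rewrite coefZ -[LHS]mulr1; congr (_ * _).
have /monicP := monic_prod_XsubC (rem a X) xpredT id.
by rewrite lead_coefE szterm.
Qed.
End Univariate.

(** * Syzygies of two plane curves with finitely many common points *)

Section Shear.
Variable K : closedFieldType.
Implicit Types (A B P Q : {mpoly K[2]}) (c : K).

Definition pt (p : K * K) : 'I_2 -> K := fun j => if j == 0 then p.1 else p.2.

(** The images of the two variables under the change of coordinates
[(x, y) |-> (x + c y, y)]. The target is [K[x][y]]: [y] is the outer variable,
the one in which divisions are performed. *)
Definition shear_var c (j : 'I_2) : {poly {poly K}} :=
  if j == 0 then 'X%:P + c%:P *: 'X else 'X.

Definition shear c : {rmorphism {mpoly K[2]} -> {poly {poly K}}} :=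
  mmap (polyC \o polyC) (shear_var c).

Lemma unshear_comm c : commr_rmorph (@mpolyC 2 K) ('X_0 - c *: 'X_1).
Proof. by move=> x; apply: mulrC. Qed.

Definition unshear c : {rmorphism {poly {poly K}} -> {mpoly K[2]}} :=
  horner_morph (f := horner_morph (unshear_comm c)) (u := 'X_1)
     (fun x => mulrC _ _).

Lemma unshearC c a : unshear c a%:P%:P = a%:MP.
Proof. exact: etrans (horner_morphC _ _) (horner_morphC _ _). Qed.

Lemma unshear_var c j : unshear c (shear_var c j) = 'X_j.
Proof.
have uX : unshear c 'X = 'X_1 by exact: horner_morphX.
rewrite /shear_var; case: (altP (j =P 0)) => [->|j0].
  rewrite rmorphD -mul_polyC rmorphM uX unshearC mul_mpolyC.
  have -> : unshear c 'X%:P = 'X_0 - c *: 'X_1.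
    exact: etrans (horner_morphC _ _) (horner_morphX _).
  by rewrite subrK.
by rewrite uX; congr 'X_(_); apply: val_inj; case: j j0 => [[|[|]]].
Qed.

Lemma shearK c : cancel (shear c) (unshear c).
Proof.
move=> A; rewrite /shear /mmap rmorph_sum [RHS]mpolyE; apply: eq_bigr => m _.
rewrite rmorphM unshearC -mul_mpolyC; congr (_ * _).
rewrite mpolyXE_id rmorph_prod; apply: eq_bigr => j _.
by rewrite rmorphXn unshear_var.
Qed.

(** Restriction to the vertical line of abscissa [x]. *)
Definition fiber (x : K) : {rmorphism {poly {poly K}} -> {poly K}} :=
  map_poly (horner_eval x).

Lemma fiberC x (f : {poly K}) : fiber x f%:P = (f.[x])%:P.
Proof. by rewrite /fiber /= map_polyC. Qed.

Lemma fiberX x : fiber x 'X = 'X.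
Proof. by rewrite /fiber /= map_polyX. Qed.

Lemma horner_fiber_shear c A x y :
  (fiber x (shear c A)).[y] = A.@[pt (x + c * y, y)].
Proof.
rewrite /shear /= /mmap rmorph_sum horner_sum mevalE; apply: eq_bigr => m _.
rewrite rmorphM fiberC hornerM !hornerC; congr (_ * _).
rewrite rmorph_prod horner_prod; apply: eq_bigr => j _.
rewrite rmorphXn horner_exp; congr (_ ^+ _).
rewrite /shear_var /pt; case: (j == 0) => /=; last by rewrite fiberX hornerX.
by rewrite rmorphD -mul_polyC rmorphM !fiberC fiberX !hornerE.
Qed.

(** The value at [(c, 1)] of the homogeneous part of degree [d] of [Q], as a
polynomial in [c]. *)
Definition top_form d Q : {poly K} :=
  \sum_(m <- msupp Q) (Q@_m *+ (mdeg m == d)) *: 'X^(m 0).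

Lemma mdeg2 (m : 'X_{1..2}) : mdeg m = (m 0%R + m 1%R)%N.
Proof. by rewrite mdegE big_ord_recl big_ord1; congr (_ + m _)%N; apply: val_inj. Qed.

Lemma mnm2P (m m' : 'X_{1..2}) : mdeg m = mdeg m' -> m 0 = m' 0 -> m = m'.
Proof.
rewrite !mdeg2 => eqd eq0; apply/mnmP => j.
have [->//|j0] := eqVneq j 0.
have -> : j = 1 by apply: val_inj; case: j j0 => [[|[|]]].
by move: eqd; rewrite eq0 => /addnI.
Qed.

Lemma top_form_neq0 d Q : msize Q = d.+1 -> top_form d Q != 0.
Proof.
move=> szQ; have Q0 : Q != 0 by rewrite -msize_poly_eq0 szQ.
have degm : mdeg (mlead Q) = d by have := mlead_deg Q0; rewrite szQ => -[].
apply: contraNneq (_ : Q@_(mlead Q) != 0); last by rewrite mleadc_eq0.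
move/(congr1 (fun p : {poly K} => p`_(mlead Q 0))).
rewrite coef0 coef_sum (bigD1_seq (mlead Q)) ?msupp_uniq ?mlead_supp //=.
rewrite coefZ coefXn degm !eqxx mulrb mulr1 big1 ?addr0 => [->//|m mQ].
rewrite coefZ coefXn; have [dm|] := eqVneq (mdeg m) d; last by rewrite mul0r.
case: eqP => [e|]; last by rewrite mulr0.
by case/eqP: mQ; apply: mnm2P; rewrite ?degm.
Qed.

(** This lemma and the next two compute all coefficients of index at least the
degree: that gives the leading coefficient and bounds the size at once. *)
Lemma coef_shear_linear c k n : (k <= n)%N ->
  (('X%:P + c%:P *: 'X : {poly {poly K}}) ^+ k)`_n = (c ^+ k *+ (n == k))%:P.
Proof.
elim: k n => [|k IH] n lekn; first by rewrite !expr0 coef1; case: (n == 0)%N.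
case: n lekn => // n lekn.
rewrite exprS mulrDl coefD coefCM -scalerAl coefZ coefXM /=.
have le1 : (k <= n.+1)%N := ltnW lekn.
rewrite (IH _ le1) (IH _ lekn) (gtn_eqF lekn) mulrb.
by rewrite mulr0 add0r -polyCM eqSS mulrnAr exprS.
Qed.

Lemma coef_shear_mnm c (m : 'X_{1..2}) n : (mdeg m <= n)%N ->
  (shear c 'X_[m])`_n = (c ^+ m 0 *+ (n == mdeg m))%:P.
Proof.
rewrite mdeg2 => len.
rewrite /shear /= mmapX /mmap1 big_ord_recl big_ord1 /shear_var /=.
have -> : lift ord0 ord0 = 1 :> 'I_2 by apply: val_inj.
rewrite -[m ord0]/(m 0).
have lemn : (m 1%R <= n)%N by lia.
rewrite coefMXn ltnNge lemn coef_shear_linear; last by lia.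
by congr (_ *+ _)%:P; congr nat_of_bool; apply/eqP/eqP; lia.
Qed.

(** For [c] outside the roots of [top_form d Q], the shear makes [Q] a
polynomial of degree [d] in [y] with an invertible leading coefficient. *)
Lemma coef_shear c d Q n : (msize Q <= d.+1)%N -> (d <= n)%N ->
   (shear c Q)`_n = ((top_form d Q).[c] *+ (n == d))%:P.
Proof.
move=> szQ ledn; rewrite [Q in LHS]mpolyE rmorph_sum coef_sum.
rewrite /top_form horner_sum -sumrMnl rmorph_sum.
apply: eq_big_seq => m /msize_mdeg_lt /leq_trans/(_ szQ); rewrite ltnS => lemd.
have -> : shear c (Q@_m *: 'X_[m]) = (Q@_m)%:P *: shear c 'X_[m].
  by rewrite -mul_mpolyC rmorphM -mul_polyC /= mmapC.
rewrite coefZ coef_shear_mnm ?(leq_trans lemd) // hornerZ hornerXn -polyCM.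
rewrite /=; congr _%:P; have [->|nd] := eqVneq n d.
  by rewrite mulrb eq_sym; case: eqP => _; rewrite ?mulr1n ?mulr0 ?mul0r.
by rewrite gtn_eqF ?mulr0 // (leq_ltn_trans lemd) // ltn_neqAle eq_sym nd.
Qed.

(** After a shear, [Q] has a unit as leading coefficient in [y], so that [A] can
be divided by [Q]; let [A'] be the remainder. On a vertical line that contains
no common zero, [P] and [Q] restrict to coprime polynomials in one variable, so
[Q] divides the restriction of [A'], which has smaller degree: [A'] vanishes on
that line. All but finitely many vertical lines are of this kind. *)
Lemma dvd_of_syzygy A B P Q (Z : seq (K * K)) :
  (forall p, P.@[pt p] = 0 -> Q.@[pt p] = 0 -> p \in Z) ->
  Q != 0 -> A * P + B * Q = 0 -> exists C, A = C * Q.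
Proof.
move=> Zfin Q0 syz.
have [d szQ] : exists d, msize Q = d.+1.
  by exists (msize Q).-1; rewrite prednK // lt0n msize_poly_eq0.
have [c cP] := closed_nonrootP _ (top_form_neq0 szQ).
have lcQ : (shear c Q)`_d = ((top_form d Q).[c])%:P.
  by rewrite (coef_shear _ (eq_leq szQ)) ?eqxx.
have szsQ : size (shear c Q) = d.+1.
  apply/anti_leq/andP; split.
    by apply/leq_sizeP => j ltdj; rewrite (coef_shear _ (eq_leq szQ)) ?gtn_eqF // ltnW.
  rewrite ltnNge; apply: contra cP => leQd.
  by rewrite rootE -polyC_eq0 -lcQ nth_default.
have unitQ : lead_coef (shear c Q) \is a GRing.unit.
  by rewrite lead_coefE szsQ lcQ poly_unitE size_polyC coefC /= cP unitfE.
have eqA := Pdiv.IdomainUnit.divp_eq unitQ (shear c A).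
suff A'0 : shear c A %% shear c Q = 0.
  exists (unshear c (shear c A %/ shear c Q)).
  by rewrite -[A in LHS](shearK c) [in LHS]eqA A'0 addr0 rmorphM shearK.
set A' := _ %% _ in eqA *.
(* The abscissas, in the sheared coordinates, of the common zeros. *)
pose bad := rootpoly [seq p.1 - c * p.2 | p <- Z].
have bad0 : bad != 0 by rewrite monic_neq0 // monic_prod_XsubC.
have fib0 x : ~~ root bad x -> fiber x A' = 0.
  move=> badx.
  have szf : size (fiber x (shear c Q)) = d.+1.
    rewrite /fiber /= size_map_poly_id0 ?szsQ //.
    by rewrite lead_coefE szsQ lcQ /horner_eval hornerC.
  have szA' : (size (fiber x A') <= d)%N.
    rewrite (leq_trans (size_poly _ _)) // -ltnS -szsQ ltn_modp.
    by rewrite -size_poly_eq0 szsQ.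
  have cop : coprimep (fiber x (shear c Q)) (fiber x (shear c P)).
    apply: Pdiv.ClosedField.root_coprimep => y.
    rewrite rootE !horner_fiber_shear => /eqP Qy; apply: contraNneq badx => Py.
    have inZ := Zfin _ Py Qy; rewrite root_prod_XsubC; apply/mapP.
    by exists (x + c * y, y) => //=; rewrite addrK.
  have : fiber x (shear c Q) %| fiber x A' * fiber x (shear c P).
    have := congr1 (fiber x \o shear c) syz.
    rewrite /= !rmorphD !rmorphM !rmorph0 {1}eqA rmorphD rmorphM mulrDl.
    move/eqP; rewrite addrAC addr_eq0 mulrAC -mulrDl => /eqP e.
    by rewrite -dvdpNr -e dvdp_mull.
  rewrite Gauss_dvdpl // => /dvdp_leq h; apply/eqP; apply: contraT => /h.
  by rewrite szf ltnNge szA'.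
apply/polyP => k; rewrite coef0; apply/eqP.
have : A'`_k * bad == 0.
  apply/negPn/negP => /closed_nonrootP[x]; rewrite rootM negb_or => /andP[Ax].
  move/fib0/(congr1 (fun p : {poly K} => p`_k)).
  by rewrite /fiber /= coef_map coef0 /horner_eval => /eqP Ax0; rewrite rootE Ax0 in Ax.
by rewrite mulf_eq0 (negPf bad0) orbF.
Qed.

End Shear.

(** * The number of monomials *)

Section Dims.
Lemma sum_ltn n k : (k <= n)%N -> (\sum_(j < n) (j < k) = k)%N.
Proof.
move=> lekn; rewrite -[RHS]card_ord -sum1_card.
by rewrite (big_ord_widen n (fun=> 1%N)) // [RHS]big_mkcond.
Qed.

(** The monomials of degree at most [b] are counted as the pairs [(i, j)] with
[i + j <= b]. *)
Lemma card_mnm2 b : (#|{: 'X_{1..2 < b.+1}}| * 2 = b.+1 * b.+2)%N.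
Proof.
pose g (m : 'X_{1..2 < b.+1}) : 'I_b.+1 * 'I_b.+1 :=
  (inord (bmnm m 0), inord (bmnm m 1)).
have lt2 (m : 'X_{1..2 < b.+1}) : (bmnm m 0%R + bmnm m 1%R < b.+1)%N.
  by rewrite -mdeg2 bmdeg.
have lt0 (m : 'X_{1..2 < b.+1}) : (bmnm m 0%R < b.+1)%N.
  by apply: leq_trans (lt2 m); rewrite ltnS leq_addr.
have lt1 (m : 'X_{1..2 < b.+1}) : (bmnm m 1%R < b.+1)%N.
  by apply: leq_trans (lt2 m); rewrite ltnS leq_addl.
have gI : injective g.
  move=> m m' [] /(congr1 val) e0 /(congr1 val) e1.
  move: e0 e1; rewrite /= !inordK ?lt0 ?lt1 // => e0 e1.
  by apply: val_inj; apply: mnm2P => //; rewrite !mdeg2 e0 e1.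
have cE : #|{: 'X_{1..2 < b.+1}}| = #|[set p : 'I_b.+1 * 'I_b.+1 | p.1 + p.2 < b.+1]|%N.
  rewrite -(card_codom gI); apply: eq_card => -[i j]; rewrite inE /=.
  apply/codomP/idP => [[m [-> ->]]|ltij].
    by have := lt2 m; rewrite !inordK ?lt0 ?lt1.
  pose m : 'X_{1..2} := [multinom (if k == 0%R then i : nat else j) | k < 2].
  have m0 : m 0 = i by rewrite mnmE.
  have m1 : m 1 = j by rewrite mnmE.
  have dm : (mdeg m < b.+1)%N by rewrite mdeg2 m0 m1.
  by exists (BMultinom dm); rewrite /g /= m0 m1 !inord_val.
rewrite cE -sum1_card big_mkcond /=.
under eq_bigr do rewrite inE.
rewrite -(pair_bigA _ (fun i j : 'I_b.+1 => if (i + j < b.+1)%N then 1%N else 0%N)) /=.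
have sumj (i : 'I_b.+1) :
    (\sum_(j < b.+1) (if (i + j < b.+1)%N then 1 else 0) = b.+1 - i)%N.
  rewrite -[RHS](sum_ltn (leq_subr i b.+1)).
  by apply: eq_bigr => j _; rewrite ltn_subRL.
under eq_bigr do rewrite sumj.
rewrite (reindex_inj rev_ord_inj) /=.
under eq_bigr => i _ do rewrite subKn //.
by elim: b.+1 => [|n IH]; [rewrite big_ord0|rewrite big_ord_recr /= mulnDl IH; lia].
Qed.
End Dims.

(** * Noether's theorem by a dimension count *)

Section Noether.
Variable K : closedFieldType.
Implicit Types (A B P Q f : {mpoly K[2]}).

Lemma msizeM_leq a b A B :
  (msize A <= a.+1)%N -> (msize B <= b.+1)%N -> (msize (A * B) <= (a + b).+1)%N.
Proof.
move=> leA leB; have [->|A0] := eqVneq A 0; first by rewrite mul0r msize0.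
have [->|B0] := eqVneq B 0; first by rewrite mulr0 msize0.
by rewrite msizeM //; have := leq_add leA leB; rewrite addSn addnS; case: (_ + _)%N.
Qed.

Lemma msizeD_leq b A B :
  (msize A <= b)%N -> (msize B <= b)%N -> (msize (A + B) <= b)%N.
Proof. by move=> leA leB; rewrite (leq_trans (mmeasureD_le _ _ _)) // geq_max leA. Qed.

(* The polynomials of degree less than [b], through their coefficients: a
   vector space of finite dimension. *)
Notation polys b := {ffun 'X_{1..2 < b} -> K^o}.

Definition poly_of b (u : polys b) : {mpoly K[2]} := \sum_m u m *: 'X_[bmnm m].

Definition coefs b A : polys b := [ffun m => A@_(bmnm m)].

Lemma poly_of_is_linear b : linear (@poly_of b).
Proof.
move=> a u w; rewrite /poly_of scaler_sumr -big_split; apply: eq_bigr => m _.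
by rewrite !ffunE scalerDl scalerA.
Qed.
HB.instance Definition _ b :=
  GRing.isLinear.Build K (polys b) {mpoly K[2]} _ (@poly_of b) (@poly_of_is_linear b).

Lemma coefs_is_linear b : linear (@coefs b).
Proof. by move=> a A B; apply/ffunP => m; rewrite !ffunE mcoeffD mcoeffZ. Qed.
HB.instance Definition _ b :=
  GRing.isLinear.Build K {mpoly K[2]} (polys b) _ (@coefs b) (@coefs_is_linear b).

Lemma coefsK b A : (msize A <= b)%N -> poly_of (coefs b A) = A.
Proof.
by move=> leA; rewrite [RHS](mpolywE leA); apply: eq_bigr => m _; rewrite ffunE.
Qed.

Lemma poly_ofK b : cancel (@poly_of b) (coefs b).
Proof.
move=> u; apply/ffunP => m; rewrite ffunE raddf_sum (bigD1 m) //=.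
rewrite mcoeffZ mcoeffX eqxx mulr1 big1 ?addr0 // => m' ne.
by rewrite mcoeffZ mcoeffX -bmeqP (negPf ne) mulr0.
Qed.

Lemma msize_poly_of b (u : polys b) : (msize (poly_of u) <= b)%N.
Proof.
rewrite /poly_of; elim/big_ind: _ => [|p q|m _]; first by rewrite msize0.
  exact: msizeD_leq.
by rewrite (leq_trans (mmeasureZ_le _ _ _)) // mmeasureX bmdeg.
Qed.

Definition combine P Q k b (u : polys k * polys k) : polys b :=
  coefs b (poly_of u.1 * P + poly_of u.2 * Q).

Lemma combine_is_linear P Q k b : linear (@combine P Q k b).
Proof.
move=> a u w; rewrite /combine -[RHS]coefs_is_linear; congr coefs; rewrite !linearP.
by rewrite !mulrDl -!scalerAl scalerDr addrACA.
Qed.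
HB.instance Definition _ P Q k b :=
  GRing.isLinear.Build K _ _ _ (@combine P Q k b) (@combine_is_linear P Q k b).

Definition koszul P Q l k (u : polys l) : polys k * polys k :=
  (coefs k (poly_of u * Q), coefs k (- poly_of u * P)).

Lemma koszul_is_linear P Q l k : linear (@koszul P Q l k).
Proof.
move=> a u w; rewrite /koszul linearP; congr pair; rewrite -[RHS]coefs_is_linear.
  by congr coefs; rewrite mulrDl -scalerAl.
by congr coefs; rewrite opprD mulrDl -scalerN -scalerAl.
Qed.
HB.instance Definition _ P Q l k :=
  GRing.isLinear.Build K _ _ _ (@koszul P Q l k) (@koszul_is_linear P Q l k).

Definition evals (Z : seq (K * K)) b (u : polys b) : {ffun 'I_(size Z) -> K^o} :=
  [ffun i : 'I_(size Z) => (poly_of u).@[pt (nth 0 Z i)]].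

Lemma evals_is_linear Z b : linear (@evals Z b).
Proof. by move=> a u w; apply/ffunP => i; rewrite !ffunE linearP mevalD mevalZ. Qed.
HB.instance Definition _ Z b :=
  GRing.isLinear.Build K _ _ _ (@evals Z b) (@evals_is_linear Z b).

(** A polynomial of degree 1 that vanishes at [q], and at [p] only if [p = q]. *)
Definition separator (p q : K * K) : {mpoly K[2]} :=
  if p.1 == q.1 then 'X_1 - q.2%:MP else 'X_0 - q.1%:MP.

Lemma msize_linear i (a : K) : (msize ('X_i - a%:MP : {mpoly K[2]}) <= 2)%N.
Proof.
apply: msizeD_leq; first by rewrite msizeX mdeg1.
by rewrite mmeasureN mmeasureC; case: eqP.
Qed.

Lemma msize_prod_linear (I : Type) (r : seq I) (F : I -> {mpoly K[2]}) :
  (forall i, msize (F i) <= 2)%N -> (msize (\prod_(i <- r) F i) <= (size r).+1)%N.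
Proof.
move=> leF; elim: r => [|i r IH]; first by rewrite big_nil msize1.
by rewrite big_cons -[(size (i :: r)).+1]/(1 + size r).+1%N; apply: msizeM_leq.
Qed.

Lemma meval_separator p q : ((separator p q).@[pt q] == 0)
   && (((separator p q).@[pt p] == 0) == (p == q)).
Proof.
rewrite /separator; case: p q => [p1 p2] [q1 q2] /=; rewrite xpair_eqE.
case: ifP => e; rewrite !mevalB !mevalXU !mevalC /pt /= ?subrr !subr_eq0 !eqxx //=.
by rewrite e.
Qed.

(** Points [Z] impose independent conditions on polynomials of degree at least
[size Z - 1]: a product of lines avoids a given point and goes through all the
others. *)
Lemma limg_evals Z b : uniq Z -> (size Z <= b)%N -> limg (linfun (@evals Z b)) = fullv.
Proof.
move=> uZ leZ; apply/eqP; rewrite eqEsubv subvf /=; apply/subvP => w _.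
pose D (i : 'I_(size Z)) : {mpoly K[2]} :=
  \prod_(q <- rem (nth 0 Z i) Z) separator (nth 0 Z i) q.
have Zi i : (i < size Z)%N -> nth 0 Z i \in Z by apply: mem_nth.
have szD i : (msize (D i) <= b)%N.
  have := msize_prod_linear (rem (nth 0 Z i) Z) (F := separator (nth 0 Z i)) _.
  rewrite size_rem ?Zi // prednK ?(leq_ltn_trans _ (ltn_ord i)) // => h.
  apply: leq_trans leZ; apply: h => q; rewrite /separator.
  by case: ifP => _; apply: msize_linear.
have Dii (i : 'I_(size Z)) : (D i).@[pt (nth 0 Z i)] != 0.
  rewrite rmorph_prod prodf_seq_neq0; apply/allP => q /=.
  rewrite mem_rem_uniq // inE => /andP[ne _].
  by have /andP[_ /eqP->] := meval_separator (nth 0 Z i) q; rewrite eq_sym.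
have Dij (i j : 'I_(size Z)) : i != j -> (D i).@[pt (nth 0 Z j)] = 0.
  move=> ne; apply/eqP; rewrite rmorph_prod prodf_seq_eq0; apply/hasP.
  exists (nth 0 Z j).
    by rewrite mem_rem_uniq // inE Zi // nth_uniq // andbT eq_sym.
  by have /andP[e _] := meval_separator (nth 0 Z i) (nth 0 Z j); rewrite /= e.
pose f := \sum_i (w i / (D i).@[pt (nth 0 Z i)]) *: D i.
apply/memv_imgP; exists (coefs b f); rewrite ?memvf // lfunE /=.
apply/ffunP => j; rewrite ffunE coefsK; last first.
  rewrite /f; elim/big_ind: _ => [|p q|i _]; [by rewrite msize0|exact: msizeD_leq|].
  by rewrite (leq_trans (mmeasureZ_le _ _ _)).
rewrite raddf_sum (bigD1 j) //= mevalZ divfK // big1 ?addr0 // => i ne.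
by rewrite mevalZ (Dij _ _ ne) mulr0.
Qed.

Lemma dim_polys b : (\dim {:polys b.+1} * 2 = b.+1 * b.+2)%N.
Proof. by rewrite dimvf -card_mnm2 /dim /= muln1. Qed.

(** The arithmetic of the dimension count, with [N k = (k + 1) (k + 2) / 2] the
dimension of the polynomials of degree at most [k]: here [n1], [n2], [n3] are
[N m], [N (m - d)], [N (m - 2 d)], and the conclusion rests on
[N m + N (m - 2 d) = 2 N (m - d) + d ^ 2]. *)
Lemma noether_count d m kE iP kP n1 n2 n3 : (d.*2 <= m)%N ->
  (kE + d ^ 2 = n1)%N -> (kP + iP = n2 * 2)%N -> (kP <= n3)%N ->
  (n1 * 2 = m.+1 * m.+2)%N -> (n2 * 2 = (m - d).+1 * (m - d).+2)%N ->
  (n3 * 2 = (m - d.*2).+1 * (m - d.*2).+2)%N -> (kE <= iP)%N.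
Proof.
move=> ledm; have [j ->] : exists j, m = (j + d * 2)%N.
  by exists (m - d.*2)%N; lia.
rewrite -muln2 !addnK (_ : j + d * 2 - d = j + d)%N; [nia|lia].
Qed.

(** The image of [(A, B) |-> A P + B Q] lies in the kernel of the evaluation at
[Z]. The kernel of that map is contained in the image of the Koszul map
[C |-> (C Q, - C P)], which bounds the dimension of the image from below by the
dimension of the kernel of the evaluation; so the two spaces are equal. *)
Lemma max_noether (d m : nat) P Q (Z : seq (K * K)) f :
  uniq Z -> size Z = (d ^ 2)%N ->
  (forall p, (p \in Z) = (P.@[pt p] == 0) && (Q.@[pt p] == 0)) ->
  (msize P <= d.+1)%N -> msize Q = d.+1 ->
  (d.*2 <= m)%N -> (d ^ 2 <= m.+1)%N -> (msize f <= m.+1)%N ->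
  (forall p, p \in Z -> f.@[pt p] = 0) ->
  exists A B, [/\ (msize A <= (m - d).+1)%N, (msize B <= (m - d).+1)%N
                & f = A * P + B * Q].
Proof.
move=> uZ szZ ZE szP szQ ledm leZm szf fZ.
set k := (m - d).+1; set l := (m - d.*2).+1.
have Q0 : Q != 0 by rewrite -msize_poly_eq0 szQ.
have szcomb A B : (msize A <= k)%N -> (msize B <= k)%N ->
    (msize (A * P + B * Q) <= m.+1)%N.
  move=> leA leB; have -> : m.+1 = ((m - d) + d).+1 by lia.
  by apply: msizeD_leq; apply: msizeM_leq => //; rewrite szQ.
pose Phi := linfun (@combine P Q k m.+1).
pose Ev := linfun (@evals Z m.+1).
pose Kos := linfun (@koszul P Q l k).
have sub1 : (limg Phi <= lker Ev)%VS.
  apply/subvP => _ /memv_imgP[u _ ->]; rewrite memv_ker !lfunE /=.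
  apply/eqP/ffunP => i; rewrite !ffunE coefsK ?szcomb ?msize_poly_of //.
  have : nth 0 Z i \in Z by rewrite mem_nth.
  by rewrite ZE mevalD !mevalM => /andP[/eqP-> /eqP->]; rewrite !mulr0 addr0.
have sub2 : (lker Phi <= limg Kos)%VS.
  apply/subvP => u; rewrite memv_ker lfunE /= => /eqP Phiu.
  have syz : poly_of u.1 * P + poly_of u.2 * Q = 0.
    have := congr1 (@poly_of m.+1) Phiu; rewrite linear0 /combine coefsK //.
    by rewrite szcomb ?msize_poly_of.
  have [C eqC] : exists C, poly_of u.1 = C * Q.
    by apply: (@dvd_of_syzygy _ _ _ _ _ Z _ Q0 syz) => p Pp Qp; rewrite ZE Pp Qp !eqxx.
  have eqC' : poly_of u.2 = - C * P.
    apply: (mulIf Q0); apply/eqP; rewrite -subr_eq0 -[X in _ == X]syz eqC.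
    by apply/eqP; ring.
  have szC : (msize C <= l)%N.
    have [->|C0] := eqVneq C 0; first by rewrite msize0.
    have := msize_poly_of u.1; rewrite eqC msizeM // szQ /k /l.
    by case: (msize C) => [|x]; lia.
  apply/memv_imgP; exists (coefs l C); rewrite ?memvf // lfunE /= /koszul.
  by rewrite coefsK // -eqC -eqC' !poly_ofK; case: (u).
have dimE : (\dim (lker Ev) + d ^ 2 = \dim {:polys m.+1})%N.
  have limE : limg Ev = fullv by rewrite limg_evals // szZ.
  rewrite -(limg_ker_dim Ev fullv) capfv limE [\dim {:_}]dimvf.
  have -> : dim {ffun 'I_(size Z) -> K^o} = (#|{: 'I_(size Z)}| * 1)%N by [].
  by rewrite muln1 card_ord -szZ.
have dimP : (\dim (lker Phi) + \dim (limg Phi) = \dim {:polys k} * 2)%N.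
  have := limg_ker_dim Phi fullv; rewrite capfv => ->; rewrite !dimvf muln2.
  by rewrite -addnn.
have dimK : (\dim (lker Phi) <= \dim {:polys l})%N.
  by rewrite (leq_trans (dimvS sub2)) // -(limg_ker_dim Kos fullv) leq_addl.
have eqV : limg Phi = lker Ev.
  apply/eqP; rewrite eqEdim sub1 /=.
  exact: (noether_count ledm dimE dimP dimK (dim_polys _) (dim_polys _) (dim_polys _)).
have : coefs m.+1 f \in limg Phi.
  rewrite eqV memv_ker lfunE /=; apply/eqP/ffunP => i.
  by rewrite !ffunE coefsK // fZ // mem_nth.
case/memv_imgP => u _; rewrite lfunE /= => /(congr1 (@poly_of m.+1)).
rewrite /combine !coefsK ?szcomb ?msize_poly_of // => ->.
by exists (poly_of u.1), (poly_of u.2); rewrite !msize_poly_of.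
Qed.
End Noether.

(** * The sum over the grid *)

Section EulerJacobi.
Variable K : closedFieldType.
Implicit Types (A B P Q h : {mpoly K[2]}) (X Y : seq K).

(** The coordinates of the points of [Z] may coincide; adding arbitrary numbers
brings both sides of the grid to the size [d ^ 2] that [max_noether] and the
degree bound call for. *)
Lemma extend_uniq X n : uniq X -> (size X <= n)%N ->
  exists Y, [/\ uniq Y, size Y = n & {subset X <= Y}].
Proof.
move=> uX /subnK <-; elim: (n - size X)%N => [|k [Y [uY szY sXY]]].
  by exists X; split.
have : rootpoly Y != 0 by rewrite monic_neq0 // monic_prod_XsubC.
case/closed_nonrootP => x; rewrite root_prod_XsubC => xY.
exists (x :: Y); split; rewrite /= ?xY ?szY // => y /sXY yY.
by rewrite inE yY orbT.
Qed.

Definition linprod (i : 'I_2) X : {mpoly K[2]} := \prod_(a <- X) ('X_i - a%:MP).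

Lemma meval_linprod i X (u : 'I_2 -> K) : (linprod i X).@[u] = (rootpoly X).[u i].
Proof.
rewrite rmorph_prod horner_prod; apply: eq_bigr => a _.
by rewrite /= mevalB mevalXU mevalC hornerXsubC.
Qed.

Lemma mderiv_linprod i j X (u : 'I_2 -> K) :
  (linprod i X)^`M(j).@[u] = (rootpoly X)^`().[u i] *+ (i == j).
Proof.
elim: X => [|a X IH].
  by rewrite /linprod /rootpoly !big_nil -mpolyC1 mderivC meval0 derivC horner0 mul0rn.
have -> : linprod i (a :: X) = ('X_i - a%:MP) * linprod i X.
  by rewrite /linprod big_cons.
have -> : rootpoly (a :: X) = ('X - a%:P) * rootpoly X.
  by rewrite /rootpoly big_cons.
rewrite mderivM mderivB mderivC subr0 mevalD !mevalM IH meval_linprod.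
rewrite mevalB mevalXU mevalC derivM derivXsubC mul1r hornerD hornerM hornerXsubC.
rewrite mderivX mevalZ mevalX mnm1E mulrnDl mulrnAr; congr (_ + _).
case: eqP => [->|_]; last by rewrite mul0r mul0r.
rewrite big1 ?mulr1 ?mul1r // => k _.
by rewrite mnmBE subnn expr0.
Qed.

Lemma msize_linprod i X : (msize (linprod i X) <= (size X).+1)%N.
Proof. by apply: msize_prod_linear => a; apply: msize_linear. Qed.

(** The sum of a monomial is a product of two sums over [X] and [Y]. As its
degree is less than [2 n], one of its exponents is less than [n], and the
corresponding factor vanishes. *)
Lemma grid_sum h X Y n : uniq X -> uniq Y -> size X = n.+1 -> size Y = n.+1 ->
  (msize h <= n.*2)%N ->
  \sum_(a <- X) \sum_(b <- Y)
     h.@[pt (a, b)] / ((rootpoly X)^`().[a] * (rootpoly Y)^`().[b]) = 0.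
Proof.
move=> uX uY szX szY szh.
pose s (W : seq K) k := \sum_(a <- W) a ^+ k / (rootpoly W)^`().[a].
transitivity (\sum_(m <- msupp h) h@_m * (s X (m 0) * s Y (m 1))); last first.
  rewrite big1_seq // => m /andP[_ /msize_mdeg_lt/leq_trans/(_ szh)].
  rewrite mdeg2 => ltm; have [lt0|le0] := ltnP (m 0%R) n.
    by rewrite /s sum_expr_div_deriv ?szX // mul0r mulr0.
  rewrite /s [X in _ * (_ * X)]sum_expr_div_deriv ?mulr0 // szY ltnS.
  by move: ltm le0; rewrite -addnn; lia.
under [RHS]eq_bigr do rewrite mulr_suml mulr_sumr.
rewrite [RHS]exchange_big; apply: eq_bigr => a _ /=.
under [RHS]eq_bigr do rewrite mulr_sumr mulr_sumr.
rewrite [RHS]exchange_big; apply: eq_bigr => b _ /=.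
rewrite mevalE mulr_suml; apply: eq_bigr => m _.
rewrite big_ord_recl big_ord1 -mulrA; congr (_ * _).
have -> : lift ord0 ord0 = 1 :> 'I_2 by apply: val_inj.
by rewrite /pt /= invfM mulrACA.
Qed.

Lemma euler_jacobi_msizeQ d P Q (Z : seq (K * K)) :
  (1 < d)%N -> uniq Z -> size Z = (d ^ 2)%N ->
  (forall p, (p \in Z) = (P.@[pt p] == 0) && (Q.@[pt p] == 0)) ->
  (msize P <= d.+1)%N -> msize Q = d.+1 ->
  \sum_(p <- Z) (P^`M(0).@[pt p] * Q^`M(1).@[pt p]
                 - P^`M(1).@[pt p] * Q^`M(0).@[pt p])^-1 = 0.
Proof.
move=> d_gt1 uZ szZ ZE szP szQ.
have szcoord (c : K * K -> K) : (size (undup (map c Z)) <= d ^ 2)%N.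
  by rewrite -szZ -(size_map c); apply: size_undup.
have [X [uX szX sX]] := extend_uniq (undup_uniq _) (szcoord fst).
have [Y [uY szY sY]] := extend_uniq (undup_uniq _) (szcoord snd).
have ZX p : p \in Z -> p.1 \in X by move=> pZ; rewrite sX // mem_undup map_f.
have ZY p : p \in Z -> p.2 \in Y by move=> pZ; rewrite sY // mem_undup map_f.
have le2d : (d.*2 <= d ^ 2)%N by rewrite -muln2 -mulnn leq_mul2l d_gt1 orbT.
have noether i W : size W = (d ^ 2)%N ->
    (forall p, p \in Z -> pt p i \in W) ->
    exists A B, [/\ (msize A <= (d ^ 2 - d).+1)%N, (msize B <= (d ^ 2 - d).+1)%N
                  & linprod i W = A * P + B * Q].
  move=> szW ZW; apply: (max_noether uZ szZ ZE szP szQ) => //.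
    by rewrite (leq_trans (msize_linprod _ _)) // szW.
  move=> p /ZW pW; rewrite meval_linprod; apply/eqP.
  by rewrite -rootE root_prod_XsubC.
have [A1 [B1 [szA1 szB1 eq1]]] := noether 0 X szX ZX.
have [A2 [B2 [szA2 szB2 eq2]]] := noether 1 Y szY ZY.
pose h := A1 * B2 - A2 * B1.
pose G (p : K * K) : K :=
  h.@[pt p] / ((rootpoly X)^`().[p.1] * (rootpoly Y)^`().[p.2]).
have szh : (msize h <= (d ^ 2).-1.*2)%N.
  (* [2 D - 2 d + 1 <= 2 (D - 1)] because [d >= 2]. *)
  have e : (((d ^ 2 - d) + (d ^ 2 - d)).+1 <= (d ^ 2).-1.*2)%N.
    by move: le2d d_gt1; case: (d ^ 2)%N => [|D] /=; lia.
  apply: leq_trans e; apply: msizeD_leq; rewrite ?mmeasureN; exact: msizeM_leq.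
(* Let [M] be the matrix with rows [(A1, B1)] and [(A2, B2)], so that
   [h = det M]. The product rule at a common zero of [P] and [Q] gives the
   matrix identity [M(p) Dv(p) = diag (r'(p), s'(p))]. *)
have G_Z p : p \in Z -> (P^`M(0).@[pt p] * Q^`M(1).@[pt p]
                 - P^`M(1).@[pt p] * Q^`M(0).@[pt p])^-1 = G p.
  move=> pZ; have := pZ; rewrite ZE => /andP[/eqP Pp /eqP Qp].
  have jac i W j A B : linprod i W = A * P + B * Q ->
      (rootpoly W)^`().[pt p i] *+ (i == j)
      = A.@[pt p] * P^`M(j).@[pt p] + B.@[pt p] * Q^`M(j).@[pt p].
    rewrite -mderiv_linprod => ->.
    by rewrite mderivD !mderivM !mevalD !mevalM Pp Qp !mulr0 !add0r.
  have r' := deriv_rootpoly_neq0 uX (ZX p pZ).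
  have s' := deriv_rootpoly_neq0 uY (ZY p pZ).
  set J := _ - _.
  have hJ : h.@[pt p] * J = (rootpoly X)^`().[p.1] * (rootpoly Y)^`().[p.2].
    have rx := jac _ _ 0 _ _ eq1; have ry := jac _ _ 1 _ _ eq1.
    have sx := jac _ _ 0 _ _ eq2; have sy := jac _ _ 1 _ _ eq2.
    transitivity ((rootpoly X)^`().[pt p 0] * (rootpoly Y)^`().[pt p 1] - 0 * 0).
      rewrite [X in X * _ - _]rx [X in _ * X - _]sy [X in _ - X * _]ry.
      by rewrite [X in _ - _ * X]sx /h mevalB !mevalM /J; ring.
    by rewrite mulr0 subr0.
  have hJ0 : h.@[pt p] * J != 0 by rewrite hJ mulf_neq0.
  rewrite /G -hJ invfM mulrA divff ?mul1r //.
  by apply: contraNneq hJ0 => ->; rewrite mul0r.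
(* Off [Z] the nonzero vector [(P(p), Q(p))] is in the kernel of [M(p)]. *)
have G_grid p : p.1 \in X -> p.2 \in Y -> p \notin Z -> G p = 0.
  move=> pX pY pZ; suff h0 : h.@[pt p] = 0 by rewrite /G h0 mul0r.
  have rel i W A B : linprod i W = A * P + B * Q -> pt p i \in W ->
      A.@[pt p] * P.@[pt p] + B.@[pt p] * Q.@[pt p] = 0.
    move=> eqW pW; rewrite -!mevalM -mevalD -eqW meval_linprod.
    by apply/eqP; rewrite -rootE root_prod_XsubC.
  have e1 := rel _ _ _ _ eq1 pX; have e2 := rel _ _ _ _ eq2 pY.
  rewrite /h mevalB !mevalM; move: e1 e2 pZ; rewrite ZE negb_and.
  move: (meval _ A1) (meval _ B1) (meval _ A2) (meval _ B2) (meval _ P) (meval _ Q).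
  move=> a1 b1 a2 b2 x y e1 e2 /orP[x0|y0].
    apply: (mulIf x0); rewrite mul0r.
    transitivity (b2 * (a1 * x + b1 * y) - b1 * (a2 * x + b2 * y)); first by ring.
    by rewrite e1 e2; ring.
  apply: (mulIf y0); rewrite mul0r.
  transitivity (a1 * (a2 * x + b2 * y) - a2 * (a1 * x + b1 * y)); first by ring.
  by rewrite e1 e2; ring.
rewrite (eq_big_seq _ G_Z).
have D_gt0 : (d ^ 2).-1.+1 = (d ^ 2)%N by rewrite prednK // expn_gt0 (ltnW d_gt1).
pose grid := [seq (a, b) | a <- X, b <- Y].
have sum_grid : \sum_(p <- grid) G p = 0.
  by rewrite big_allpairs; apply: grid_sum szh; rewrite ?D_gt0.
have ugrid : uniq grid by apply: allpairs_uniq => // -[? ?] [? ?].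
rewrite -[RHS]sum_grid [RHS](bigID (fun p => p \in Z)) /=.
rewrite [X in _ + X]big1_seq ?addr0; last first.
  move=> p /andP[nZ /allpairsP[q [qX qY pq]]].
  by apply: G_grid => //; rewrite pq.
rewrite -[RHS]big_filter; apply: perm_big; apply: uniq_perm => //.
  exact: filter_uniq.
move=> p; rewrite mem_filter; case: (boolP (p \in Z)) => //= pZ.
by apply/esym/allpairsP; exists p; split; [exact: ZX|exact: ZY|case: (p)].
Qed.

(** By the symmetry between [P] and [Q], whose exchange changes the sign of the
Jacobian determinant, [Q] can be assumed to have the maximal degree. *)
Lemma euler_jacobi d P Q (Z : seq (K * K)) :
  (1 < d)%N -> uniq Z -> size Z = (d ^ 2)%N ->
  (forall p, (p \in Z) = (P.@[pt p] == 0) && (Q.@[pt p] == 0)) ->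
  maxn (msize P) (msize Q) = d.+1 ->
  \sum_(p <- Z) (P^`M(0).@[pt p] * Q^`M(1).@[pt p]
                 - P^`M(1).@[pt p] * Q^`M(0).@[pt p])^-1 = 0.
Proof.
move=> d_gt1 uZ szZ ZE hmax.
have leP : (msize P <= d.+1)%N by rewrite -hmax leq_maxl.
have leQ : (msize Q <= d.+1)%N by rewrite -hmax leq_maxr.
have [szQ|szQ] := eqVneq (msize Q) d.+1; first exact: euler_jacobi_msizeQ szQ.
have szP : msize P = d.+1 by lia.
have ZE' p : (p \in Z) = (Q.@[pt p] == 0) && (P.@[pt p] == 0).
  by rewrite ZE andbC.
have := euler_jacobi_msizeQ d_gt1 uZ szZ ZE' leQ szP.
move/(congr1 -%R); rewrite oppr0 -sumrN => sum0.
rewrite -[RHS]sum0; apply: eq_bigr => p _.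
by rewrite -invrN opprB; congr (_ - _)^-1; apply: mulrC.
Qed.
End EulerJacobi.

(** * The theorem *)

Lemma det_mx2 (T : comNzRingType) (A : 'M[T]_2) :
  \det A = A 0 0 * A 1 1 - A 0 1 * A 1 0.
Proof.
rewrite (expand_det_row _ 0) big_ord_recl big_ord1 /cofactor !det_mx11 !mxE /=.
have -> : ord0 = 0 :> 'I_2 by [].
have -> : lift 0 0 = 1 :> 'I_2 by apply: val_inj.
have -> : lift 1 0 = 0 :> 'I_2 by apply: val_inj.
by rewrite expr0 expr1 mul1r mulN1r mulrN.
Qed.

Local Open Scope classical_set_scope.
Local Open Scope card_scope.

Theorem mainTheorem3 (R : realType) (v : vfield R) (d : nat)
  (hd1 : d <> 1%N)
  (hdeg : has_degree v d)
  (hcard : singularities v #= `I_(d ^ 2))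
  (hnd : forall p : cplane R, singularities v p -> nondegenerate_at v p) :
  \sum_(p \in singularities v) (\det (linearization_at v p))^-1 = 0.
Proof.
have finS : finite_set (singularities v) by exists (d ^ 2)%N.
pose s : seq (cplane R) := finmap.enum_fset (fset_set (singularities v)).
have us : uniq s by apply: finmap.fset_uniq.
have szs : size s = (d ^ 2)%N by apply: card_fset_set.
have sE p : (p \in s) = (eval_vf v p == 0).
  rewrite [p \in s]in_fset_set //.
  by apply/idP/eqP; rewrite inE.
rewrite fsbig_finite //= -/s.
have [d0|d0] := eqVneq d 0%N.
  by move: szs; rewrite d0 => /size0nil ->; rewrite big_nil.
have d_gt1 : (1 < d)%N by lia.
pose coords (p : cplane R) := (p 0 0, p 0 1).
have ptE p : pt (coords p) =1 (fun j => p 0 j).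
  move=> j; rewrite /pt; case: eqP => [->//|/eqP j0] /=.
  by congr (p 0 _); apply: val_inj; case: j j0 => [[|[|]]].
have coordsI : injective coords.
  by move=> p q pq; apply/rowP => j; rewrite -!ptE pq.
pose Z := map coords s.
have uZ : uniq Z by rewrite map_inj_uniq.
have szZ : size Z = (d ^ 2)%N by rewrite size_map.
have ZE u : (u \in Z) = ((v 0 0).@[pt u] == 0) && ((v 0 1).@[pt u] == 0).
  pose p : cplane R := \row_j pt u j.
  have up : u = coords p by rewrite /coords !mxE /pt /= -surjective_pairing.
  rewrite up mem_map // sE !(meval_eq _ (ptE p)).
  apply/eqP/andP => [/rowP e|[/eqP e0 /eqP e1]].
    by have := e 0; have := e 1; rewrite !mxE => -> ->; rewrite !eqxx.
  apply/rowP => j; rewrite !mxE.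
  have [->//|j0] := eqVneq j 0.
  by rewrite -[RHS]e1; congr ((v 0 _).@[_]); apply: val_inj; case: j j0 => [[|[|]]].
pose J i k (u : R[i] * R[i]) : R[i] := ((v 0 i)^`M(k)).@[pt u].
have detE p : \det (linearization_at v p) =
    J 0 0 (coords p) * J 1 1 (coords p) - J 0 1 (coords p) * J 1 0 (coords p).
  have JE i k : linearization_at v p i k = J i k (coords p).
    by rewrite mxE /J (meval_eq _ (ptE p)).
  by rewrite det_mx2 !JE.
under eq_bigr do rewrite detE.
rewrite -(big_map coords xpredT
  (fun u => (J 0 0 u * J 1 1 u - J 0 1 u * J 1 0 u)^-1)) -/Z.
exact: euler_jacobi d_gt1 uZ szZ ZE hdeg.
Qed.
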